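(* Let $G$ be a 3-associative inversional local topological groupoid over $M$. Then its associative completion $\mathcal{AC}(G)$ is a topological groupoid over $M$, and the completion map $G\to\mathcal{AC}(G)$ is a morphism of local topological groupoids. Moreover, given any topological groupoid $\mathcal H$ and any morphism $F:G\to\mathcal H$ of local topological groupoids, there exists a unique morphism of topological groupoids $\tilde F:\mathcal{AC}(G)\to\mathcal H$ such that $F$ equals the composition of the completion map $G\to\mathcal{AC}(G)$ with $\tilde F$.
   Context: Write $X\,{}_s\!\times_t Y=\{(g,h)\in X\times Y: s(g)=t(h)\}$. A local topological groupoid $G$ over $M$ consists of topological spaces $G,M$ with: continuous open maps $s,t:G\to M$ (source, target); a continuous map $u:M\to G$ (unit; $M$ is identified with $u(M)$); a continuous open map $m:\mathcal U\to G$, $m(g,h)=gh$ (multiplication), where $\mathcal U\subset G\,{}_s\!\times_t G$ is an open neighborhood of $\bigcup_{g\in G}\{(g,u(s(g))),(u(t(g)),g)\}$; a continuous map $i:\mathcal V\to\mathcal V$ (inversion), where $\mathcal V\subset G$ is an open neighborhood of $u(M)$ with $\mathcal V\,{}_s\!\times_t\mathcal V\subset\mathcal U$; such that: $s(gh)=s(h)$, $t(gh)=t(g)$ for $(g,h)\in\mathcal U$; $(gh)k=g(hk)$ on a subset of $G\,{}_s\!\times_t G\,{}_s\!\times_t G$ whose interior contains $(M\,{}_s\!\times_t M\,{}_s\!\times_t G)\cup(M\,{}_s\!\times_t G\,{}_s\!\times_t M)\cup(G\,{}_s\!\times_t M\,{}_s\!\times_t M)$; $g\,u(s(g))=u(t(g))\,g=g$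 for all $g\in G$; $s(i(g))=t(g)$, $t(i(g))=s(g)$, $i(g)g=u(s(g))$, $g\,i(g)=u(t(g))$ for $g\in\mathcal V$. (This is the topological version of the definition of local Lie groupoid, with submersions replaced by continuous open maps.) It is 3-associative if $(gh)k=g(hk)$ whenever both sides are defined. A topological groupoid is viewed as a local one with $\mathcal U$ all composable pairs and $\mathcal V$ all arrows. Elements of $\mathcal V$ are called invertible. $G$ is inversional if each of its elements can be written as a well-defined product (for some bracketing) of invertible elements. A morphism from $G_1$ over $M_1$ to $G_2$ over $M_2$ is a pair of continuous maps $F:G_1\to G_2$, $f:M_1\to M_2$ with $F\circ u_1=u_2\circ f$, $f\circ s_1=s_2\circ F$, $f\circ t_1=t_2\circ F$, $(F\times F)(\mathcal U_1)\subset\mathcal U_2$ and $F\circ m_1=m_2\circ(F\times F)$ on $\mathcal U_1$, $F(\mathcal V_1)\subset\mathcal V_2$ and $F\circ i_1=i_2\circ F$ on $\mathcal V_1$. Let $W(G)=\bigsqcup_{n\ge1}G\,{}_s\!\times_t\cdots{}_s\!\times_t G$ ($n$ factors) be the space of well-formed words. If $(w_k,w_{k+1})\in\mathcal U$, the word $(w_1,\dots,w_kw_{k+1},\dots,w_n)$ is a contraction of $(w_1,\dots,w_n)$ and the latter is an expansion of the former; $\sim$ is the equivalence relation generated by contractions and expansions. The associative completion is $\mathcal{AC}(G)=W(G)/\!\sim$ with the quotient topology; its source and target are $s([w_1,\dots,w_n])=s(w_n)$, $t([w_1,\dots,w_n])=t(w_1)$, multiplication is juxtaposition of words, and the unit at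 $x$ is $[x]$. The completion map $G\to\mathcal{AC}(G)$ sends $g$ to $[(g)]$. *)

(* Defs.v *)
From Stdlib Require Import Relation_Operators.
From HB Require Import structures.
From mathcomp Require Import all_boot generic_quotient all_classical topology function_spaces.

Set Implicit Arguments.
Unset Strict Implicit.
Unset Printing Implicit Defensive.

Local Open Scope classical_set_scope.

Definition open_map (X Y : topologicalType) (f : X -> Y) : Prop :=
  forall O : set X, open O -> open (f @` O).

Definition open_map_on (X Y : topologicalType) (A : set X) (f : X -> Y) : Prop :=
  forall O : set X, open O -> open (f @` (A `&` O)).

(* G {}_s x_t G and G {}_s x_t G {}_s x_t G *)
Definition composable (G M : Type) (s t : G -> M) : set (G * G) :=
  [set p | s p.1 = t p.2].

Definition composable3 (G M : Type) (s t : G -> M) : set (G * G * G) :=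
  [set p | s p.1.1 = t p.1.2 /\ s p.1.2 = t p.2].

(* Multiplication and inversion are partial: they are represented by total
   functions [mul] and [inv], whose values outside their domains [mdom] (the
   set U) and [idom] (the set V) are irrelevant, since every axiom is restricted
   to these domains.
   A set that is open in [subspace A] and contained in [A] is a relatively open
   subset of [A]; the interior in [subspace A] of a set at a point of [A] is the
   relative interior.
   The fields [src_ident] and [tgt_ident] express the identification of M with
   u(M). *)
Record localGroupoid (G M : topologicalType) := LocalGroupoid {
  src : G -> M ;
  tgt : G -> M ;
  ident : M -> G ;
  mdom : set (G * G) ;
  mul : G -> G -> G ;
  idom : set G ;
  inv : G -> G ;

  src_continuous : continuous src ;
  src_open : open_map src ;
  tgt_continuous : continuous tgt ;
  tgt_open : open_map tgt ;
  ident_continuous : continuous ident ;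
  src_ident : forall x, src (ident x) = x ;
  tgt_ident : forall x, tgt (ident x) = x ;

  mdom_composable : mdom `<=` composable src tgt ;
  mdom_open : open (mdom : set (subspace (composable src tgt))) ;
  mdom_identr : forall g, mdom (g, ident (src g)) ;
  mdom_identl : forall g, mdom (ident (tgt g), g) ;
  mul_continuous : {within mdom, continuous (fun p : G * G => mul p.1 p.2)} ;
  mul_open : open_map_on mdom (fun p : G * G => mul p.1 p.2) ;

  idom_open : open idom ;
  idom_ident : forall x, idom (ident x) ;
  idom_mdom : forall g h, idom g -> idom h -> src g = tgt h -> mdom (g, h) ;
  inv_idom : forall g, idom g -> idom (inv g) ;
  inv_continuous : {within idom, continuous inv} ;

  src_mul : forall g h, mdom (g, h) -> src (mul g h) = src h ;
  tgt_mul : forall g h, mdom (g, h) -> tgt (mul g h) = tgt g ;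
  mul_identr : forall g, mul g (ident (src g)) = g ;
  mul_identl : forall g, mul (ident (tgt g)) g = g ;

  mul_assoc_near : forall g h k, composable3 src tgt (g, h, k) ->
    [\/ range ident g /\ range ident h,
        range ident g /\ range ident k
      | range ident h /\ range ident k] ->
    interior
      ([set p : G * G * G |
         let: (a, b, c) := p in
         [/\ mdom (a, b), mdom (mul a b, c), mdom (b, c), mdom (a, mul b c)
           & mul (mul a b) c = mul a (mul b c)]]
       : set (subspace (composable3 src tgt)))
      (g, h, k) ;

  src_inv : forall g, idom g -> src (inv g) = tgt g ;
  tgt_inv : forall g, idom g -> tgt (inv g) = src g ;
  mul_invl : forall g, idom g -> mul (inv g) g = ident (src g) ;
  mul_invr : forall g, idom g -> mul g (inv g) = ident (tgt g)
}.

Section LocalGroupoidTheory.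
Variables (G M : topologicalType) (S : localGroupoid G M).

Definition three_associative : Prop := forall g h k,
  mdom S (g, h) -> mdom S (mul S g h, k) ->
  mdom S (h, k) -> mdom S (g, mul S h k) ->
  mul S (mul S g h) k = mul S g (mul S h k).

Inductive invertible_product : G -> Prop :=
| invertible_product_idom g : idom S g -> invertible_product g
| invertible_product_mul g h : invertible_product g -> invertible_product h ->
    mdom S (g, h) -> invertible_product (mul S g h).

Definition inversional : Prop := forall g, invertible_product g.

Definition topological_groupoid : Prop :=
  [/\ mdom S = composable (src S) (tgt S),
      idom S = setT
    & forall g h k, src S g = tgt S h -> src S h = tgt S k ->
        mul S (mul S g h) k = mul S g (mul S h k)].

(* [wordn n] is the n.+1-fold fibre product, with the subspace topology of the
   product topology; [word] carries the disjoint union topology. *)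
Definition wordn (n : nat) : set {ptws 'I_n.+1 -> G} :=
  [set w | forall i j : 'I_n.+1, j = i.+1 :> nat -> src S (w i) = tgt S (w j)].

Arguments wordn _ _ : clear implicits.

Definition word : topologicalType := {n : nat & set_type (wordn n)}.

Definition mkword (n : nat) (w : {ptws 'I_n.+1 -> G}) (wP : w \in wordn n) :
  word := existT _ n (exist (fun v => v \in wordn n) w wP).

Definition letter (w : word) (i : 'I_(projT1 w).+1) : G := val (projT2 w) i.

Definition letters (w : word) : seq G := [seq letter i | i : 'I_(projT1 w).+1].

Definition word_src (w : word) : M := src S (letter (w := w) ord_max).
Definition word_tgt (w : word) : M := tgt S (letter (w := w) ord0).

Lemma wordn1_subproof (g : G) : (fun=> g : G) \in wordn 0.
Proof. by apply: mem_set => i j; rewrite !ord1. Qed.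

Definition word1 (g : G) : word := mkword (wordn1_subproof g).

Section Juxtaposition.
Variables (w w' : word).

Definition word_cat_fun (i : 'I_((projT1 w).+1 + (projT1 w').+1)) : G :=
  match fintype.split i with inl j => letter j | inr j => letter j end.

Hypothesis ww' : word_src w = word_tgt w'.

Lemma word_cat_subproof :
  (word_cat_fun : {ptws 'I_(projT1 w + (projT1 w').+1).+1 -> G}) \in
  wordn (projT1 w + (projT1 w').+1).
Proof.
apply: mem_set => i j ji; rewrite /word_cat_fun.
pose m := (projT1 w).+1; pose n := (projT1 w').+1.
case: (@split_ordP m n i) => i' ei; case: (@split_ordP m n j) => j' ej.
- apply: (set_mem (valP (projT2 w))).
  by move: ji; rewrite ei ej.
- have hi := ltn_ord i'; move: ji; rewrite ei ej /= => ji.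
  have ei' : i' = ord_max.
    by apply: val_inj => /=; apply/eqP; rewrite eqn_leq -ltnS hi -ltnS -ji leq_addr.
  have ej' : j' = ord0.
    by apply: val_inj; apply/eqP; rewrite /= -(eqn_add2l (projT1 w).+1) ji ei' addn0.
  by rewrite ei' ej'; exact: ww'.
- have hj := ltn_ord j'; move: ji; rewrite ei ej /= => ji.
  by move: (leq_trans hj (leq_addr i' m)); rewrite ji ltnNge leqnSn.
- apply: (set_mem (valP (projT2 w'))).
  by move: ji; rewrite ei ej /= -addnS => /addnI.
Qed.

Definition word_cat : word := mkword word_cat_subproof.

End Juxtaposition.

(* [contraction w w'] : w' is a contraction of w *)
Definition contraction (w w' : word) : Prop :=
  exists (p q : seq G) (g h : G),
    [/\ mdom S (g, h),
        letters w = p ++ [:: g, h & q]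
      & letters w' = p ++ mul S g h :: q].

Definition word_equiv : rel word :=
  fun w w' => `[< clos_refl_sym_trans word contraction w w' >].

Lemma word_equiv_refl : reflexive word_equiv.
Proof. by move=> w; apply/asboolP; exact: rst_refl. Qed.

Lemma word_equiv_sym : symmetric word_equiv.
Proof.
by move=> w w'; apply/idP/idP => /asboolP e; apply/asboolP; exact: rst_sym.
Qed.

Lemma word_equiv_trans : transitive word_equiv.
Proof.
by move=> b a c /asboolP ab /asboolP bc; apply/asboolP; exact: rst_trans ab bc.
Qed.

Canonical word_equiv_rel :=
  EquivRel word_equiv word_equiv_refl word_equiv_sym word_equiv_trans.

Definition assoc_completion : topologicalType :=
  quotient_topology {eq_quot word_equiv_rel}%qT.

Definition word_class (w : word) : assoc_completion :=
  (\pi_(quotient_topology {eq_quot word_equiv_rel}%qT) w)%qT.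

Definition completion_map (g : G) : assoc_completion := word_class (word1 g).

(* The source, target, unit and multiplication of A are those of the associative
   completion; as [word_class] is onto, they are determined by these equations. *)
Definition completion_structure (A : localGroupoid assoc_completion M) : Prop :=
  [/\ forall w, src A (word_class w) = word_src w,
      forall w, tgt A (word_class w) = word_tgt w,
      forall x, ident A x = word_class (word1 (ident S x))
    & forall w w' (ww' : word_src w = word_tgt w'),
        mul A (word_class w) (word_class w') = word_class (word_cat ww')].

End LocalGroupoidTheory.

Record morphism (G1 M1 G2 M2 : topologicalType)
    (S1 : localGroupoid G1 M1) (S2 : localGroupoid G2 M2)
    (F : G1 -> G2) (f : M1 -> M2) : Prop := Morphism {
  morphism_continuous : continuous F ;
  morphism_base_continuous : continuous f ;
  morphism_ident : forall x, F (ident S1 x) = ident S2 (f x) ;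
  morphism_src : forall g, f (src S1 g) = src S2 (F g) ;
  morphism_tgt : forall g, f (tgt S1 g) = tgt S2 (F g) ;
  morphism_mdom : forall g h, mdom S1 (g, h) -> mdom S2 (F g, F h) ;
  morphism_mul : forall g h, mdom S1 (g, h) ->
    F (mul S1 g h) = mul S2 (F g) (F h) ;
  morphism_idom : forall g, idom S1 g -> idom S2 (F g) ;
  morphism_inv : forall g, idom S1 g -> F (inv S1 g) = inv S2 (F g)
}.

(* Main.v *)
(* Contracting a word is an open operation because m is an open map, and
   expanding is one because m is continuous on an open domain. Hence saturations
   of open sets of words are open and the projection from words to the
   completion is open. Juxtaposition of words is continuous and open, so
   multiplication in the completion is too; the completion map is open, and the
   images of the invertible elements generate the completion. Openness or
   continuity of source, target, inversion and of the extension of a morphism is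
   therefore inherited: it holds at [g] for g invertible, and it passes from a
   and b to their product ab, since products a'b' with a' near a and b' near b
   fill a neighbourhood of ab. *)

From Stdlib Require List.
From Stdlib Require Import Relation_Operators.
Require Import Defs.
From mathcomp Require Import all_boot all_classical topology function_spaces.
From mathcomp Require Import generic_quotient.
(* [mul] and [inv] must refer to Defs, not to mathcomp. *)
Import Defs.

Set Implicit Arguments.
Unset Strict Implicit.
Unset Printing Implicit Defensive.

Local Open Scope classical_set_scope.

(** * Pointwise related sequences, and boxes in the topology of pointwise convergence *)

Lemma Forall2_map (I A B : Type) (R : A -> B -> Prop) (f : I -> A) (g : I -> B)
    (s : seq I) :
  (forall i, R (f i) (g i)) -> List.Forall2 R (map f s) (map g s).
Proof. by move=> Rfg; elim: s => //= i s; constructor. Qed.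

Lemma Forall2_nth (A B : Type) (R : A -> B -> Prop) a b s t i :
  List.Forall2 R s t -> i < size s -> R (nth a s i) (nth b t i).
Proof. by move=> st; elim: st i => // x y {}s {}t ? _ ih [|i] //= /ih. Qed.

Lemma Forall2_size (A B : Type) (R : A -> B -> Prop) s t :
  List.Forall2 R s t -> size s = size t.
Proof. by elim=> //= x y {}s {}t _ _ ->. Qed.

(** The boxes around [f] generate a filter that converges to [f] in the initial topology of every
    coordinate, hence in their supremum, the pointwise topology. *)
Lemma ptws_nbhs_box (I : choiceType) (T : topologicalType) (f : {ptws I -> T})
    (U : set {ptws I -> T}) :
  nbhs f U -> exists B : I -> set T, (forall i, nbhs (f i) (B i)) /\
    (forall g : {ptws I -> T}, (forall i, B i (g i)) -> U g).
Proof.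
pose F := filter_from [set B : I -> set T | forall i, nbhs (f i) (B i)]
  (fun B => [set g : {ptws I -> T} | forall i, B i (g i)]).
have FF : Filter F.
  apply: filter_from_filter.
    by exists (fun=> setT) => i /=; exact: filterT.
  move=> B C nB nC; exists (fun i => B i `&` C i) => [i|g BC].
    exact: filterI.
  by split=> i; case: (BC i).
have Ff : F --> f.
  apply/cvg_sup => i V [_ [[A oA <-] Afi sub]].
  exists (fun j => if j == i then A else setT) => [j /=|g /= Bg].
    by case: eqP => [->|_]; [exact: open_nbhs_nbhs | exact: filterT].
  by apply: sub => /=; have := Bg i; rewrite eqxx.
by move=> /Ff [B nB BU]; exists B; split.
Qed.

(** * Words as sequences of letters *)

Section Words.
Variables (G M : topologicalType) (S : localGroupoid G M).
Local Notation word := (word S).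

Definition joinable : rel G := [rel g h | src S g == tgt S h].

Lemma size_letters (w : word) : size (letters w) = (projT1 w).+1.
Proof. by rewrite size_map size_enum_ord. Qed.

Lemma nth_letters (x : G) (w : word) (i : 'I_(projT1 w).+1) :
  nth x (letters w) i = letter i.
Proof. by rewrite (nth_map i) ?size_enum_ord// nth_ord_enum. Qed.

Lemma letters_nil (w : word) : letters w <> [::].
Proof. by move=> /(congr1 size); rewrite size_letters. Qed.

Lemma letters_sorted (w : word) : sorted joinable (letters w).
Proof.
have x := letter (w := w) ord0.
apply/(sortedP x) => i; rewrite size_letters => ilt.
apply/eqP; pose j := Ordinal (ltnW ilt); pose k := Ordinal ilt.
rewrite (nth_letters x j) (nth_letters x k).
exact: (set_mem (valP (projT2 w))).
Qed.

(** With [letters_surj], this trades dependently typed words for nonempty sequences sorted by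
    [joinable]: words are built from, and compared through, such sequences. *)
Lemma letters_inj : injective (letters (S := S)).
Proof.
move=> [n [f fP]] [m [g gP]] e.
have nm : n = m by have := congr1 size e; rewrite !size_letters /= => -[].
subst m; congr existT; apply: val_inj; apply/funext => i.
have := congr1 (fun s => nth (f ord0) s i) e.
by rewrite (nth_letters _ (w := existT _ n (exist _ f fP)) i)
  (nth_letters _ (w := existT _ n (exist _ g gP)) i).
Qed.

Lemma letters_surj (s : seq G) : s <> [::] -> sorted joinable s ->
  exists w : word, letters w = s.
Proof.
case: s => // x s _ /(sortedP x) /= xs.
have fP :
    (fun i : 'I_(size s).+1 => nth x (x :: s) i) \in wordn S (n := size s).
  by apply: mem_set => i j ij; have := ltn_ord j; rewrite ij => /xs/eqP.
exists (mkword fP); apply: (@eq_from_nth _ x) => [|i].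
  by rewrite size_letters.
rewrite size_letters => /= ilt.
by rewrite (nth_letters _ (w := mkword fP) (Ordinal ilt)).
Qed.

Lemma letters_word1 g : letters (word1 S g) = [:: g].
Proof.
apply: (@eq_from_nth _ g) => [|i]; first by rewrite size_letters.
rewrite size_letters => /=; case: i => // ilt.
exact: (nth_letters _ (w := word1 S g) (Ordinal ilt)).
Qed.

Lemma letters_cat (w w' : word) (ww' : word_src w = word_tgt w') :
  letters (word_cat ww') = letters w ++ letters w'.
Proof.
have x := letter (w := w) ord0.
apply: (@eq_from_nth _ x) => [|i].
  by rewrite size_cat !size_letters /= addSn.
rewrite size_letters /= => ilt.
rewrite (nth_letters _ (w := word_cat ww') (Ordinal ilt)) nth_cat size_letters.
rewrite /letter /= /word_cat_fun; case: split_ordP => j ej.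
  by rewrite (congr1 val ej : i = _) /= ltn_ord nth_letters.
by rewrite (congr1 val ej : i = _) /= ltnNge leq_addr /= addKn nth_letters.
Qed.

Lemma word_srcE x (w : word) : word_src w = src S (last x (letters w)).
Proof.
rewrite (last_nth x) size_letters.
exact: (congr1 (src S) (esym (nth_letters x (w := w) ord_max))).
Qed.

Lemma word_tgtE x (w : word) : word_tgt w = tgt S (head x (letters w)).
Proof. by rewrite -nth0 (nth_letters x (w := w) ord0). Qed.

(** Boxes with one factor per letter form a base of neighbourhoods; the length of [B] singles out
    the summand of the disjoint union. Listing the factors lets boxes be cut and joined along with
    words. *)
Lemma nbhs_wordP (w : word) (U : set word) : nbhs w U <->
  exists2 B : seq (set G), List.Forall2 nbhs (letters w) B &
    forall v : word, List.Forall2 (fun g A => A g) (letters v) B -> U v.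
Proof.
split.
  case: w => n f [_ [[A oA <-] Af AU]].
  have /ptws_nbhs_box[B [nB BA]] : nbhs (set_val f) A by exact: open_nbhs_nbhs.
  exists [seq B i | i : 'I_n.+1]; first exact: Forall2_map.
  move=> [m g] gB; have := Forall2_size gB.
  rewrite size_letters size_map size_enum_ord => -[/= mn]; subst m.
  apply: AU => /=; apply: BA => i.
  have := Forall2_nth (set_val f i) setT gB.
  move=> /(_ i); rewrite size_letters => /(_ (ltn_ord _)).
  rewrite (nth_letters _ (w := existT _ n g) i).
  by rewrite (nth_map i) ?size_enum_ord// nth_ord_enum.
move=> [B]; case: w => n f nB BU.
have sB := Forall2_size nB; rewrite size_letters /= in sB.
have fB (i : 'I_n.+1) : nbhs (set_val f i) (nth setT B i).
  have := Forall2_nth (set_val f i) setT nB (i := i).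
  rewrite size_letters (nth_letters _ (w := existT _ n f) i).
  by apply; exact: ltn_ord.
have evc (i : 'I_n.+1) :
    {for f, continuous (fun h : set_type (wordn S (n := n)) => set_val h i)}.
  apply: (@continuous_comp _ {ptws 'I_n.+1 -> G} _ set_val (fun h => h i)).
    exact: (@initial_continuous _ _ set_val).
  exact: (@proj_continuous _ (fun=> G) i).
pose W := set_type (wordn S (n := n)).
(* A word has finitely many letters, so the conditions on them can be imposed together. *)
have : nbhs (f : W)
    [set h : W | forall i : 'I_n.+1, nth setT B i (set_val h i)].
  exact: (filter_forall (nbhs_filter (f : W)) (fun i => evc i _ (fB i))).
apply: filterS => h hB; apply: BU.
suff -> : B = [seq nth setT B i | i : 'I_n.+1] by exact: Forall2_map.
apply: (@eq_from_nth _ setT) => [|i].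
  by rewrite size_map -sB size_enum_ord.
rewrite -sB => ilt.
by rewrite (nth_map (Ordinal ilt)) ?size_enum_ord// nth_enum_ord.
Qed.

End Words.

(** * Cutting pointwise related sequences *)

Section Forall2.
Variables (A B : Type) (R : A -> B -> Prop).

Lemma Forall2_consl x l s : List.Forall2 R (x :: l) s ->
  exists y t, [/\ R x y, List.Forall2 R l t & s = y :: t].
Proof. by inversion 1; do 2 eexists; split; eauto. Qed.

Lemma Forall2_consr s y t : List.Forall2 R s (y :: t) ->
  exists x l, [/\ R x y, List.Forall2 R l t & s = x :: l].
Proof. by inversion 1; do 2 eexists; split; eauto. Qed.

Lemma Forall2_catl l1 l2 s : List.Forall2 R (l1 ++ l2) s ->
  exists t1 t2, [/\ List.Forall2 R l1 t1, List.Forall2 R l2 t2 & s = t1 ++ t2].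
Proof.
by move=> /List.Forall2_app_inv_l[t1 [t2 [? [? ->]]]]; exists t1, t2.
Qed.

Lemma Forall2_catr s t1 t2 : List.Forall2 R s (t1 ++ t2) ->
  exists l1 l2, [/\ List.Forall2 R l1 t1, List.Forall2 R l2 t2 & s = l1 ++ l2].
Proof.
by move=> /List.Forall2_app_inv_r[l1 [l2 [? [? ->]]]]; exists l1, l2.
Qed.

End Forall2.

(** * Openness of the projection onto the completion *)

Section LocalMultiplication.
Variables (G M : topologicalType) (S : localGroupoid G M).

(** Openness of the multiplication, applied to the interior of the box [A] times [B]. *)
Lemma mul_nbhs g h (A B : set G) : mdom S (g, h) -> nbhs g A -> nbhs h B ->
  nbhs (mul S g h)
    [set k | exists a b, [/\ A a, B b, mdom S (a, b) & k = mul S a b]].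
Proof.
move=> gh nA nB.
have AB : nbhs (g, h) (A `*` B) by exists (A, B).
have oAB := mul_open S (@open_interior _ (A `*` B)).
have : nbhs (mul S g h) ((fun p => mul S p.1 p.2) @` (mdom S `&` (A `*` B)°)).
  by apply: open_nbhs_nbhs; split=> //; exists (g, h).
apply: filterS => _ [[a b] [ab /interior_subset[Aa Bb]] <-].
by exists a, b.
Qed.

Lemma mul_near g h (C : set G) : mdom S (g, h) -> nbhs (mul S g h) C ->
  exists A B, [/\ nbhs g A, nbhs h B & forall a b, A a -> B b ->
    src S a = tgt S b -> mdom S (a, b) /\ C (mul S a b)].
Proof.
move=> gh nC.
(* [V] is open in the whole product and agrees with [mdom S] on composable pairs. *)
have /open_subspaceP[V oV VU] := mdom_open (l := S).
have /subspace_continuousP/(_ _ gh C nC) nD := mul_continuous (l := S).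
have Vgh : V (g, h).
  suff [] : (V `&` composable (src S) (tgt S)) (g, h) by [].
  by rewrite VU; split=> //; exact: mdom_composable gh.
have nV : nbhs (g, h) V by exact: open_nbhs_nbhs.
have [[A B] /= [nA nB] AB] := filterI nV nD.
exists A, B; split=> // a b Aa Bb ab.
have [|Vab Dab] := AB (a, b); first by [].
suff abU : mdom S (a, b) by split=> //; exact: Dab.
suff [] : (mdom S `&` composable (src S) (tgt S)) (a, b) by [].
by rewrite -VU.
Qed.

Lemma idom_nbhs g : idom S g -> nbhs g (idom S).
Proof. by move=> gV; apply: open_nbhs_nbhs; split=> //; exact: idom_open. Qed.

Lemma inv_near g (A : set G) : idom S g -> nbhs (inv S g) A ->
  nbhs g [set h | idom S h /\ A (inv S h)].
Proof.
move=> gV nA.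
have /subspace_continuousP/(_ _ gV A nA) := inv_continuous (l := S).
by apply: filterS2 (idom_nbhs gV) => h hV /(_ hV).
Qed.

End LocalMultiplication.

Section Completion.
Variables (G M : topologicalType) (S : localGroupoid G M).
Local Notation word := (word S).
Local Notation joinable := (joinable S).
Local Notation "w ~~~ w'" :=
  (clos_refl_sym_trans word (contraction (S := S)) w w') (at level 70).

(** [mul S g h] has the target of [g] and the source of [h], so it fits between the same
    neighbours. *)
Lemma sorted_mul p q g h : mdom S (g, h) ->
  sorted joinable (p ++ mul S g h :: q) = sorted joinable (p ++ [:: g, h & q]).
Proof.
move=> gh; have jgh : joinable g h by apply/eqP; exact: mdom_composable gh.
have tail : path joinable (mul S g h) q = path joinable h q.
  by case: q => //= x q; rewrite /joinable /= src_mul.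
case: p => [|x p]; first by rewrite /= jgh tail.
by rewrite /= !cat_path /= jgh tail /joinable /= tgt_mul.
Qed.

Definition saturation (U : set word) : set word :=
  [set v | exists2 u, U u & u ~~~ v].

(** In a box around [w], the factors at [g] and [h] are replaced by the set of products of their
    elements, a neighbourhood of [mul S g h]. A word in the new box expands to one in the old
    box. *)
Lemma contraction_nbhs w w' (U : set word) : contraction w w' ->
  nbhs w U -> nbhs w' (saturation U).
Proof.
move=> [p [q [g [h [gh wE w'E]]]]] /nbhs_wordP[Bs]; rewrite wE => nBs.
have [Bp [Bgh [nBp nBgh ->]]] := Forall2_catl nBs.
have [A [Bh [nA nBh ->]]] := Forall2_consl nBgh.
have [B [Bq [nB nBq ->]]] := Forall2_consl nBh => BU.
apply/nbhs_wordP; rewrite w'E.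
eexists (Bp ++ _ :: Bq).
  apply: List.Forall2_app => //; apply: List.Forall2_cons nBq.
  exact: mul_nbhs nA nB.
move=> v vBs.
have [p' [q0 [Bp' Bq0 vE]]] := Forall2_catr vBs.
have [k [q' [[a [b [Aa Bb ab kE]]] Bq' q0E]]] := Forall2_consr Bq0.
rewrite q0E kE in vE.
have [|//|u uE] := @letters_surj _ _ S (p' ++ [:: a, b & q']).
    by case: (p').
  by rewrite -sorted_mul// -vE letters_sorted.
exists u; last by apply: rst_step; exists p', q', a, b.
apply: BU; rewrite uE; apply: List.Forall2_app => //.
by do 2!apply: List.Forall2_cons => //.
Qed.

(** In a box around [w'], the factor at [mul S g h] is replaced by two factors so small that
    adjacent letters from them multiply into it. A word in the new box contracts to one in the old
    box. *)
Lemma expansion_nbhs w w' (U : set word) : contraction w w' ->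
  nbhs w' U -> nbhs w (saturation U).
Proof.
move=> [p [q [g [h [gh wE w'E]]]]] /nbhs_wordP[Bs]; rewrite w'E => nBs.
have [Bp [Bgh [nBp nBgh ->]]] := Forall2_catl nBs.
have [C [Bq [nC nBq ->]]] := Forall2_consl nBgh => CU.
have [A [B [nA nB AB]]] := mul_near gh nC.
apply/nbhs_wordP; rewrite wE; exists (Bp ++ [:: A, B & Bq]).
  by apply: List.Forall2_app => //; do 2!apply: List.Forall2_cons => //.
move=> v vBs.
have [p' [q0 [Bp' Bq0 vE]]] := Forall2_catr vBs.
have [a [q1 [Aa Bq1 q0E]]] := Forall2_consr Bq0.
have [b [q' [Bb Bq' q1E]]] := Forall2_consr Bq1; rewrite q0E q1E in vE.
(* Well-formedness of [v] supplies the composability that [mul_near] requires. *)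
have /eqP ab : joinable a b.
  have := letters_sorted v; rewrite vE; case: (p') => [/=/andP[]//|x p''].
  by rewrite /= cat_path /= => /and4P[].
have [{}ab Cab] := AB a b Aa Bb ab.
have [|//|u uE] := @letters_surj _ _ S (p' ++ mul S a b :: q').
    by case: (p').
  by rewrite sorted_mul// -vE letters_sorted.
exists u; last by apply/rst_sym/rst_step; exists p', q', a, b.
by apply: CU; rewrite uE; apply: List.Forall2_app => //; constructor.
Qed.

Lemma word_equiv_nbhs w w' (U : set word) : w ~~~ w' ->
  nbhs w U -> nbhs w' (saturation U).
Proof.
(* Both directions are carried together, so that the symmetry case merely swaps them. *)
move=> e; suff [+ _] : (forall U, nbhs w U -> nbhs w' (saturation U)) /\
  (forall U, nbhs w' U -> nbhs w (saturation U)) by apply.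
(* The transfer of neighbourhoods composes because saturating twice is saturating once. *)
have trans (u v x : word) : (forall U, nbhs u U -> nbhs v (saturation U)) ->
    (forall U, nbhs v U -> nbhs x (saturation U)) ->
    forall U, nbhs u U -> nbhs x (saturation U).
  move=> uv vx V /uv/vx; apply: filterS => y [y1 [y2 Vy y21] y1y].
  by exists y2 => //; exact: rst_trans y21 y1y.
elim: e => {w w' U} [w w' ww'|w|w w' _ []|w v w' _ [wv vw] _ [vw' w'v]] //.
- by split=> U; [exact: contraction_nbhs | exact: expansion_nbhs].
- by split=> U; apply: filterS => u Uu; exists u => //; exact: rst_refl.
- by split; [exact: trans wv vw' | exact: trans w'v vw].
Qed.

Lemma word_equiv_src w w' : w ~~~ w' -> word_src w = word_src w'.
Proof.
elim=> {w w'} [w w' [p [q [g [h [gh wE w'E]]]]]|//|w w' _ //|w v w' _ -> //].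
rewrite !(word_srcE g) wE w'E !last_cat /=; case: q {wE w'E} => //=.
by rewrite src_mul.
Qed.

Lemma word_equiv_tgt w w' : w ~~~ w' -> word_tgt w = word_tgt w'.
Proof.
elim=> {w w'} [w w' [p [q [g [h [gh wE w'E]]]]]|//|w w' _ //|w v w' _ -> //].
rewrite !(word_tgtE g) wE w'E; case: p {wE w'E} => //=.
by rewrite tgt_mul.
Qed.

(** [word_cat] takes a proof of composability, so the induction quantifies over both proofs;
    [word_equiv_src] supplies one at an intermediate word. *)
Lemma word_equiv_catl w v w' (ww' : word_src w = word_tgt w')
    (vw' : word_src v = word_tgt w') :
  w ~~~ v -> word_cat ww' ~~~ word_cat vw'.
Proof.
move=> e; elim: e ww' vw' => {w v}.
- move=> w v [p [q [g [h [gh wE vE]]]]] ww' vw'; apply: rst_step.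
  by exists p, (q ++ letters w'), g, h; rewrite !letters_cat wE vE -!catA.
- by move=> w e e'; rewrite (eq_irrelevance e e'); exact: rst_refl.
- by move=> w v _ ih e e'; exact: rst_sym.
- move=> w u v wu ihwu _ ihuv e e'.
  have e'' : word_src u = word_tgt w' by rewrite -(word_equiv_src wu).
  exact: rst_trans (ihwu e e'') (ihuv e'' e').
Qed.

Lemma word_equiv_catr w v w' (ww' : word_src w = word_tgt w')
    (wv : word_src w = word_tgt v) :
  w' ~~~ v -> word_cat ww' ~~~ word_cat wv.
Proof.
move=> e; elim: e ww' wv => {w' v}.
- move=> w' v [p [q [g [h [gh w'E vE]]]]] ww' wv; apply: rst_step.
  by exists (letters w ++ p), q, g, h; rewrite !letters_cat w'E vE -!catA.
- by move=> w' e e'; rewrite (eq_irrelevance e e'); exact: rst_refl.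
- by move=> w' v _ ih e e'; exact: rst_sym.
- move=> w' u v w'u ihwu _ ihuv e e'.
  have e'' : word_src w = word_tgt u by rewrite -(word_equiv_tgt w'u).
  exact: rst_trans (ihwu e e'') (ihuv e'' e').
Qed.

Local Notation AC := (assoc_completion S).

Lemma word_classP w w' : word_class w = word_class w' <-> w ~~~ w'.
Proof.
have H := @eqmodP _ (word_equiv_rel S) w w'.
by split=> [/H/asboolP|/asboolP/H].
Qed.

Lemma word_class_surj (a : AC) : exists w, word_class w = a.
Proof. by exists (repr a); exact: reprK. Qed.

Lemma word_class_continuous : continuous (word_class (S := S)).
Proof. exact: pi_continuous. Qed.

(** The preimage of the image of an open set is its saturation, open by [word_equiv_nbhs]; so the
    image is open in the quotient topology. *)
Lemma word_class_nbhs w (U : set word) : nbhs w U ->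
  nbhs (word_class w) (word_class (S := S) @` U).
Proof.
move=> nU; have UU : (@word_class _ _ S @` U°) `<=` @word_class _ _ S @` U.
  by apply: image_subset; exact: interior_subset.
apply: (filterS UU); apply: open_nbhs_nbhs; split; last by exists w.
suff : open (word_class (S := S) @^-1` (word_class (S := S) @` U°)) by [].
rewrite openE => v /= [u Uu /word_classP uv].
apply: filterS (_ : nbhs v (saturation U°)).
  by move=> x [y Uy /word_classP]; exists y.
apply: word_equiv_nbhs uv _; apply: open_nbhs_nbhs; split=> //.
exact: open_interior.
Qed.

(** * Algebra and topology of the completion *)

Definition ac_src (a : AC) : M := word_src (repr a : word).
Definition ac_tgt (a : AC) : M := word_tgt (repr a : word).
(** The value [a] at classes that are not composable is arbitrary. *)
Definition ac_mul (a b : AC) : AC :=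
  match pselect (word_src (repr a : word) = word_tgt (repr b : word)) with
  | left ab => word_class (word_cat ab)
  | right _ => a
  end.

Local Notation cmap := (completion_map S).

Lemma repr_word_class w : (repr (word_class w) : word) ~~~ w.
Proof. by apply/word_classP; exact: reprK. Qed.

Lemma ac_src_class w : ac_src (word_class w) = word_src w.
Proof. exact/word_equiv_src/repr_word_class. Qed.

Lemma ac_tgt_class w : ac_tgt (word_class w) = word_tgt w.
Proof. exact/word_equiv_tgt/repr_word_class. Qed.

Lemma ac_mul_class w w' (ww' : word_src w = word_tgt w') :
  ac_mul (word_class w) (word_class w') = word_class (word_cat ww').
Proof.
rewrite /ac_mul; case: pselect => [e|]; last first.
  by case; rewrite (word_equiv_src (repr_word_class w)) ww'
    (word_equiv_tgt (repr_word_class w')).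
apply/word_classP.
have e' : word_src w = word_tgt (repr (word_class w') : word).
  by rewrite ww' (word_equiv_tgt (repr_word_class w')).
apply: rst_trans (word_equiv_catl e e' (repr_word_class w)) _.
exact/word_equiv_catr/repr_word_class.
Qed.

Lemma ac_src_map g : ac_src (cmap g) = src S g.
Proof. by rewrite ac_src_class (word_srcE g) letters_word1. Qed.

Lemma ac_tgt_map g : ac_tgt (cmap g) = tgt S g.
Proof. by rewrite ac_tgt_class (word_tgtE g) letters_word1. Qed.

Lemma ac_src_mul a b : ac_src a = ac_tgt b -> ac_src (ac_mul a b) = ac_src b.
Proof.
have [[w <-] [w' <-]] := (word_class_surj a, word_class_surj b).
rewrite ac_src_class ac_tgt_class => ww'.
rewrite (ac_mul_class ww') !ac_src_class.
have x := letter (w := w) ord0.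
rewrite !(word_srcE x) letters_cat last_cat.
by case: (letters w') (@letters_nil _ _ _ w').
Qed.

Lemma ac_tgt_mul a b : ac_src a = ac_tgt b -> ac_tgt (ac_mul a b) = ac_tgt a.
Proof.
have [[w <-] [w' <-]] := (word_class_surj a, word_class_surj b).
rewrite ac_src_class ac_tgt_class => ww'.
rewrite (ac_mul_class ww') !ac_tgt_class.
have x := letter (w := w) ord0.
rewrite !(word_tgtE x) letters_cat.
by case: (letters w) (@letters_nil _ _ _ w).
Qed.

Lemma ac_mulA a b c : ac_src a = ac_tgt b -> ac_src b = ac_tgt c ->
  ac_mul (ac_mul a b) c = ac_mul a (ac_mul b c).
Proof.
(* The ends of the inner products are recorded before passing to representatives; they make the
   outer juxtapositions well formed. *)
move=> ab bc; have := ac_tgt_mul bc; have := ac_src_mul ab; move: ab bc.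
have [u <-] := word_class_surj a; have [v <-] := word_class_surj b.
have [w <-] := word_class_surj c.
rewrite !ac_src_class !ac_tgt_class => uv vw.
rewrite (ac_mul_class uv) (ac_mul_class vw) ac_src_class ac_tgt_class => e e'.
rewrite ac_mul_class ?e// => e1; rewrite ac_mul_class ?e'// => e2.
by congr word_class; apply: letters_inj; rewrite !letters_cat catA.
Qed.

Lemma completion_map_mul g h : mdom S (g, h) ->
  cmap (mul S g h) = ac_mul (cmap g) (cmap h).
Proof.
move=> gh; have e : word_src (word1 S g) = word_tgt (word1 S h).
  rewrite (word_srcE g) (word_tgtE g) !letters_word1.
  exact: mdom_composable gh.
rewrite /completion_map ac_mul_class; apply/word_classP/rst_sym/rst_step.
by exists [::], [::], g, h; rewrite letters_cat !letters_word1.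
Qed.

(** One contraction absorbs the appended unit into the last letter. *)
Lemma ac_mul_identr a x : ac_src a = x -> ac_mul a (cmap (ident S x)) = a.
Proof.
have [w <-] := word_class_surj a; rewrite ac_src_class => wx.
have e : word_src w = word_tgt (word1 S (ident S x)).
  by rewrite (word_tgtE (ident S x)) letters_word1 /= tgt_ident.
rewrite ac_mul_class; apply/word_classP/rst_step.
case/lastP wE: (letters w) => [|p g]; first by have := letters_nil wE.
move: wx; rewrite (word_srcE g) wE last_rcons => wx.
exists p, [::], g, (ident S x); split; first by rewrite -wx; exact: mdom_identr.
  by rewrite letters_cat letters_word1 wE cat_rcons.
by rewrite -wx mul_identr wE cats1.
Qed.

Lemma ac_mul_identl a x : ac_tgt a = x -> ac_mul (cmap (ident S x)) a = a.
Proof.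
have [w <-] := word_class_surj a; rewrite ac_tgt_class => wx.
have e : word_src (word1 S (ident S x)) = word_tgt w.
  by rewrite (word_srcE (ident S x)) letters_word1 /= src_ident.
rewrite ac_mul_class; apply/word_classP/rst_step.
case wE: (letters w) => [|g q]; first by have := letters_nil wE.
move: wx; rewrite (word_tgtE g) wE /= => wx.
exists [::], q, (ident S x), g; split; first by rewrite -wx; exact: mdom_identl.
  by rewrite letters_cat letters_word1 wE.
by rewrite -wx mul_identl.
Qed.

(** Each letter is a product of invertible elements, and a word is the product of its letters, as
    peeling off the first one shows. *)
Lemma ac_ind (P : AC -> Prop) : inversional S ->
  (forall g, idom S g -> P (cmap g)) ->
  (forall a b, ac_src a = ac_tgt b -> P a -> P b -> P (ac_mul a b)) ->
  forall a, P a.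
Proof.
move=> S_inv PV Pmul.
have Pmap g : P (cmap g).
  elim: (S_inv g) => {g} [g /PV //|g h _ Pg _ Ph gh].
  rewrite completion_map_mul//; apply: Pmul => //.
  by rewrite ac_src_map ac_tgt_map; exact: mdom_composable gh.
move=> a; have [w <-] := word_class_surj a.
move: {2}(letters w) (erefl (letters w)) => s.
elim: s w {a} => [w /letters_nil//|g s ih w wE].
have [s0|/eqP s0] := eqVneq s [::].
  suff -> : w = word1 S g by exact: Pmap.
  by apply: letters_inj; rewrite wE s0 letters_word1.
have := letters_sorted w; rewrite wE /= => ws.
have [|v vE] := @letters_surj _ _ S s s0; first exact: path_sorted ws.
have e : word_src (word1 S g) = word_tgt v.
  rewrite (word_srcE g) (word_tgtE g) letters_word1 vE /=.
  by case: (s) s0 ws => //= h s' _ /andP[/eqP].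
suff -> : w = word_cat e.
  rewrite -ac_mul_class; apply: Pmul; last exact: ih.
    by rewrite ac_src_class ac_tgt_class.
  exact: Pmap.
by apply: letters_inj; rewrite letters_cat letters_word1 vE wE.
Qed.

Lemma completion_map_continuous : continuous cmap.
Proof.
move=> g U nU; have /nbhs_wordP[B] := word_class_continuous nU.
rewrite letters_word1 => nB BU; have [A [Bs [nA Bs0 BE]]] := Forall2_consl nB.
apply: filterS nA => h Ah; apply: BU; rewrite letters_word1 BE.
by apply: List.Forall2_cons => //; inversion Bs0; constructor.
Qed.

Lemma completion_map_nbhs g (U : set G) :
  nbhs g U -> nbhs (cmap g) (cmap @` U).
Proof.
move=> nU; have nW : nbhs (word1 S g) [set w | exists2 h, U h & w = word1 S h].
  apply/nbhs_wordP; rewrite letters_word1; exists [:: U].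
    by apply: List.Forall2_cons; [exact: nU | constructor].
  move=> v vU; have [h [l [Uh l0 vE]]] := Forall2_consr vU; exists h => //.
  by apply: letters_inj; rewrite letters_word1 vE; inversion l0.
by apply: filterS (word_class_nbhs nW) => _ [_ [h Uh ->] <-]; exists h.
Qed.

(** A box around the juxtaposed word is cut into boxes around the two factors; their images are
    neighbourhoods because the projection is open. *)
Lemma ac_mul_near a b (C : set AC) : ac_src a = ac_tgt b ->
  nbhs (ac_mul a b) C ->
  exists A B, [/\ nbhs a A, nbhs b B & forall a' b', A a' -> B b' ->
    ac_src a' = ac_tgt b' -> C (ac_mul a' b')].
Proof.
have [[w <-] [w' <-]] := (word_class_surj a, word_class_surj b).
rewrite ac_src_class ac_tgt_class => ww'; rewrite (ac_mul_class ww') => nC.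
have /nbhs_wordP[Bs nBs BC] := word_class_continuous nC.
rewrite letters_cat in nBs; have [B [B' [nB nB' BsE]]] := Forall2_catl nBs.
pose box (D : seq (set G)) : set word :=
  [set v | List.Forall2 (fun g A => A g) (letters v) D].
exists (word_class (S := S) @` box B), (word_class (S := S) @` box B').
split; [by apply: word_class_nbhs; apply/nbhs_wordP; exists B|
  by apply: word_class_nbhs; apply/nbhs_wordP; exists B'|].
move=> _ _ [v Bv <-] [v' Bv' <-]; rewrite ac_src_class ac_tgt_class => vv'.
rewrite (ac_mul_class vv'); apply: BC; rewrite letters_cat BsE.
exact: List.Forall2_app.
Qed.

(** Words near a juxtaposition can be cut at the same place into words near each of its factors. *)
Lemma ac_mul_nbhs a b (A B : set AC) : ac_src a = ac_tgt b ->
  nbhs a A -> nbhs b B ->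
  nbhs (ac_mul a b)
    [set c | exists a' b',
      [/\ A a', B b', ac_src a' = ac_tgt b' & c = ac_mul a' b']].
Proof.
have [[w <-] [w' <-]] := (word_class_surj a, word_class_surj b).
rewrite ac_src_class ac_tgt_class => ww' nA nB; rewrite (ac_mul_class ww').
have /nbhs_wordP[Bs nBs BsA] := word_class_continuous nA.
have /nbhs_wordP[Bs' nBs' BsB] := word_class_continuous nB.
have nW : nbhs (word_cat ww')
    [set u | List.Forall2 (fun g A => A g) (letters u) (Bs ++ Bs')].
  apply/nbhs_wordP; exists (Bs ++ Bs') => //; rewrite letters_cat.
  exact: List.Forall2_app.
apply: filterS (word_class_nbhs nW) => _ [u uB <-].
have [l [l' [lB lB' uE]]] := Forall2_catr uB.
(* The two pieces have the lengths of [w] and [w'], so neither is empty. *)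
have l0 : l <> [::].
  move=> l0; move: lB; rewrite l0 => /Forall2_size/esym.
  by rewrite -(Forall2_size nBs) size_letters.
have l'0 : l' <> [::].
  move=> l'0; move: lB'; rewrite l'0 => /Forall2_size/esym.
  by rewrite -(Forall2_size nBs') size_letters.
have := letters_sorted u; rewrite uE => us.
have [v vE] := letters_surj l0 (cat_sorted2 us).1.
have [v' v'E] := letters_surj l'0 (cat_sorted2 us).2.
have vv' : word_src v = word_tgt v'.
  have x := letter (w := u) ord0.
  rewrite (word_srcE x) (word_tgtE x) vE v'E.
  case: l l0 us {uE vE lB v} => // h l _; case: l' l'0 {v'E lB'} => // h' l' _.
  by rewrite /= cat_path /= => /and3P[_ /eqP].
exists (word_class v), (word_class v'); split.
- by apply: BsA; rewrite vE.
- by apply: BsB; rewrite v'E.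
- by rewrite ac_src_class ac_tgt_class.
- rewrite (ac_mul_class vv'); congr word_class; apply: letters_inj.
  by rewrite letters_cat vE v'E.
Qed.

End Completion.

Lemma nbhs_open_map (X Y : topologicalType) (f : X -> Y) :
  (forall x U, nbhs x U -> nbhs (f x) (f @` U)) -> open_map f.
Proof.
move=> fU O oO; rewrite openE => _ [x Ox <-].
by apply: fU; exact: open_nbhs_nbhs.
Qed.

(** * Inversion and the groupoid structure *)

Section CompletionGroupoid.
Variables (G M : topologicalType) (S : localGroupoid G M).
Hypothesis S_inv : inversional S.
Local Notation AC := (assoc_completion S).
Local Notation cmap := (completion_map S).
Local Notation "a ** b" := (@ac_mul _ _ S a b)
  (at level 40, left associativity).
Implicit Types a b c : AC.

(** Inverses are characterised by equations rather than written as reversed words, since a letter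
    need not be invertible in [S]. *)
Definition ac_inverse a b := [/\ ac_src b = ac_tgt a, ac_tgt b = ac_src a,
  b ** a = cmap (ident S (ac_src a)) & a ** b = cmap (ident S (ac_tgt a))].

Lemma ac_inverse_map g : idom S g -> ac_inverse (cmap g) (cmap (inv S g)).
Proof.
move=> gV; have g'V := inv_idom gV.
split; rewrite ?ac_src_map ?ac_tgt_map ?src_inv ?tgt_inv//.
- rewrite -completion_map_mul ?mul_invl//.
  by apply: idom_mdom => //; exact: src_inv.
- rewrite -completion_map_mul ?mul_invr//.
  by apply: idom_mdom => //; rewrite tgt_inv.
Qed.

Lemma ac_inverse_mul a b a' b' : ac_src a = ac_tgt b ->
  ac_inverse a a' -> ac_inverse b b' -> ac_inverse (a ** b) (b' ** a').
Proof.
move=> ab [a's a't a'a aa'] [b's b't b'b bb'].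
have b'a' : ac_src b' = ac_tgt a' by rewrite b's a't.
split; rewrite ?ac_src_mul ?ac_tgt_mul//.
- rewrite ac_mulA ?ac_tgt_mul// -[a' ** _]ac_mulA// a'a.
  by rewrite ac_mul_identl.
- rewrite ac_mulA ?ac_tgt_mul ?b't// -[b ** _]ac_mulA ?b't// bb'.
  by rewrite ac_mul_identl// a't.
Qed.

(** [b = b (a b') = (b a) b' = b']. *)
Lemma ac_inverse_uniq a b b' : ac_inverse a b -> ac_inverse a b' -> b = b'.
Proof.
move=> [bs bt ba _] [b's b't _ ab'].
rewrite -[LHS](ac_mul_identr bs) -ab' -ac_mulA// ba.
by rewrite ac_mul_identl.
Qed.

(** The default [a] only makes the choice total: an inverse exists by [ac_invP]. *)
Definition ac_inv a : AC := xget a [set b | ac_inverse a b].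

Lemma ac_invP a : ac_inverse a (ac_inv a).
Proof.
suff [b ab] : exists b, ac_inverse a b by exact: (xgetI a ab).
move: a; apply: (ac_ind S_inv) => [g gV|a b ab [a' aa'] [b' bb']].
  by exists (cmap (inv S g)); exact: ac_inverse_map.
by exists (b' ** a'); exact: ac_inverse_mul.
Qed.

Lemma ac_inv_unique a b : ac_inverse a b -> ac_inv a = b.
Proof. exact/ac_inverse_uniq/ac_invP. Qed.

Lemma ac_inv_continuous : continuous ac_inv.
Proof.
suff near c C : nbhs (ac_inv c) C -> nbhs c (ac_inv @^-1` C) by exact: near.
move: c C; apply: (ac_ind S_inv) => [g gV|a b ab iha ihb] C.
  rewrite (ac_inv_unique (ac_inverse_map gV)) => nC.
  (* Classes near that of an invertible [g] come from invertible [h] near [g], whose inverses are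
     known. *)
  have nV := inv_near gV (completion_map_continuous nC).
  apply: filterS (completion_map_nbhs S nV) => _ [h [hV Ch] <-].
  by rewrite /= (ac_inv_unique (ac_inverse_map hV)).
rewrite (ac_inv_unique (ac_inverse_mul ab (ac_invP a) (ac_invP b))) => nC.
have b'a' : ac_src (ac_inv b) = ac_tgt (ac_inv a).
  by have [[_ -> _ _] [-> _ _ _]] := (ac_invP a, ac_invP b).
(* The inverse of a product is the reversed product of the inverses, so [B] surrounds [ac_inv b] and
   [A] surrounds [ac_inv a]. *)
have [B [A [nB nA BA]]] := ac_mul_near b'a' nC.
apply: filterS (ac_mul_nbhs ab (iha _ nA) (ihb _ nB)).
move=> _ [a' [b' [Aa Bb a'b' ->]]].
rewrite /= (ac_inv_unique (ac_inverse_mul a'b' (ac_invP a') (ac_invP b'))).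
apply: BA => //.
by have [[_ -> _ _] [-> _ _ _]] := (ac_invP a', ac_invP b').
Qed.

Lemma ac_src_continuous : continuous (@ac_src G M S).
Proof.
suff near c C :
    nbhs (ac_src c) C -> nbhs c ((@ac_src G M S) @^-1` C) by exact: near.
move: c C; apply: (ac_ind S_inv) => [g gV|a b ab iha ihb] C.
  rewrite ac_src_map => /(src_continuous (l := S)) nC.
  apply: filterS (completion_map_nbhs S nC) => _ [h Ch <-].
  by rewrite /= ac_src_map.
rewrite ac_src_mul// => /ihb nC.
apply: filterS (ac_mul_nbhs ab filterT nC) => _ [a' [b' [_ Cb a'b' ->]]].
by rewrite /= ac_src_mul.
Qed.

Lemma ac_tgt_continuous : continuous (@ac_tgt G M S).
Proof.
suff near c C :
    nbhs (ac_tgt c) C -> nbhs c ((@ac_tgt G M S) @^-1` C) by exact: near.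
move: c C; apply: (ac_ind S_inv) => [g gV|a b ab iha ihb] C.
  rewrite ac_tgt_map => /(tgt_continuous (l := S)) nC.
  apply: filterS (completion_map_nbhs S nC) => _ [h Ch <-].
  by rewrite /= ac_tgt_map.
rewrite ac_tgt_mul// => /iha nC.
apply: filterS (ac_mul_nbhs ab nC filterT) => _ [a' [b' [Ca _ a'b' ->]]].
by rewrite /= ac_tgt_mul.
Qed.

Lemma ac_src_open : open_map (@ac_src G M S).
Proof.
apply: nbhs_open_map; apply: (ac_ind S_inv) => [g gV|a b ab iha ihb] U nU.
  rewrite ac_src_map.
  have nV := nbhs_interior (completion_map_continuous nU).
  have oV := src_open S (open_interior (cmap @^-1` U)).
  have nW : nbhs (src S g) (src S @` (cmap @^-1` U)°).
    apply: open_nbhs_nbhs; split=> //; exists g => //.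
    exact: nbhs_singleton nV.
  apply: filterS nW => _ [h /interior_subset Uh <-].
  by exists (cmap h) => //; rewrite ac_src_map.
have [A [B [nA nB AB]]] := ac_mul_near ab nU.
rewrite ac_src_mul//.
(* The sources of [A] fill a neighbourhood of [ac_src a = ac_tgt b], so each [b'] close to [b] has a
   composable partner [a'] in [A]. *)
have nA' : nbhs b (@ac_tgt G M S @^-1` (@ac_src G M S @` A)).
  by apply: ac_tgt_continuous; rewrite -ab; exact: iha.
apply: filterS (ihb _ (filterI nB nA')) => _ [b' [Bb [a' Aa a'b'] <-]].
by exists (a' ** b'); [exact: AB | rewrite ac_src_mul].
Qed.

Lemma ac_tgt_open : open_map (@ac_tgt G M S).
Proof.
apply: nbhs_open_map; apply: (ac_ind S_inv) => [g gV|a b ab iha ihb] U nU.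
  rewrite ac_tgt_map.
  have nV := nbhs_interior (completion_map_continuous nU).
  have oV := tgt_open S (open_interior (cmap @^-1` U)).
  have nW : nbhs (tgt S g) (tgt S @` (cmap @^-1` U)°).
    apply: open_nbhs_nbhs; split=> //; exists g => //.
    exact: nbhs_singleton nV.
  apply: filterS nW => _ [h /interior_subset Uh <-].
  by exists (cmap h) => //; rewrite ac_tgt_map.
have [A [B [nA nB AB]]] := ac_mul_near ab nU.
rewrite ac_tgt_mul//.
(* Dually, each [a'] close to [a] has a composable partner [b'] in [B]. *)
have nB' : nbhs a (@ac_src G M S @^-1` (@ac_tgt G M S @` B)).
  by apply: ac_src_continuous; rewrite ab; exact: ihb.
apply: filterS (iha _ (filterI nA nB')) => _ [a' [Aa [b' Bb a'b'] <-]].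
by exists (a' ** b'); [exact: AB | rewrite ac_tgt_mul].
Qed.

Local Notation AC2 := (composable (@ac_src G M S) (@ac_tgt G M S)).

Lemma ac_mul_continuous :
  {within AC2, continuous (fun p : AC * AC => p.1 ** p.2)}.
Proof.
apply/subspace_continuousP => -[a b] ab C nC.
have [A [B [nA nB AB]]] := ac_mul_near ab nC.
exists (A, B) => // -[a' b'] [/= Aa Bb] a'b'; exact: AB.
Qed.

Lemma ac_mul_open : open_map_on AC2 (fun p : AC * AC => p.1 ** p.2).
Proof.
move=> O oO; rewrite openE => _ [[a b] [ab Oab] <-].
have [[A B] [/= nA nB] AB] : nbhs (a, b) O by exact: open_nbhs_nbhs.
apply: filterS (ac_mul_nbhs ab nA nB) => _ [a' [b' [Aa Bb a'b' ->]]].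
by exists (a', b') => //; split=> //; exact: AB.
Qed.

(** [Defined] keeps the fields transparent, so that later proofs can compute the projections. *)
Definition ac_groupoid : localGroupoid AC M.
Proof.
refine (@LocalGroupoid AC M (@ac_src G M S) (@ac_tgt G M S)
  (cmap \o ident S) AC2
  (@ac_mul _ _ S) setT ac_inv ac_src_continuous ac_src_open ac_tgt_continuous
  ac_tgt_open _ _ _ _ _ _ _ ac_mul_continuous ac_mul_open
  openT _ _ _ _ _ _ _ _ _ _ _ _ _).
- move=> x; apply: continuous_comp; first exact: ident_continuous.
  exact: completion_map_continuous.
- by move=> x; rewrite /= ac_src_map src_ident.
- by move=> x; rewrite /= ac_tgt_map tgt_ident.
- by [].
- exact: open_subspaceT.
- by move=> a; rewrite /composable /= ac_tgt_map tgt_ident.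
- by move=> a; rewrite /composable /= ac_src_map src_ident.
- by [].
- by [].
- by [].
- exact/continuous_subspaceT/ac_inv_continuous.
- by move=> a b; exact: ac_src_mul.
- by move=> a b; exact: ac_tgt_mul.
- by move=> a; exact: ac_mul_identr.
- by move=> a; exact: ac_mul_identl.
- move=> a b c abc _; rewrite /interior; apply/(nbhs_subspace_ex _ abc).
  (* Associativity holds at every composable triple, so the whole subspace is the required
     neighbourhood. *)
  exists setT; first exact: filterT.
  rewrite setTI; apply/setIidPr => -[[a' b'] c'] [/= ab' bc'].
  split=> //; rewrite /composable /= ?ac_src_mul ?ac_tgt_mul//.
  exact: ac_mulA.
- by move=> a _; have [] := ac_invP a.
- by move=> a _; have [] := ac_invP a.
- by move=> a _; have [] := ac_invP a.
- by move=> a _; have [] := ac_invP a.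
Defined.

End CompletionGroupoid.

(** * Extension of morphisms *)

Section TopologicalGroupoid.
Variables (H N : topologicalType) (T : localGroupoid H N).
Hypothesis T_grp : topological_groupoid T.

Lemma groupoid_mdom x y : src T x = tgt T y -> mdom T (x, y).
Proof. by have [-> _ _] := T_grp. Qed.

Lemma groupoid_mulA x y z : src T x = tgt T y -> src T y = tgt T z ->
  mul T (mul T x y) z = mul T x (mul T y z).
Proof. by have [_ _] := T_grp; apply. Qed.

(** A left inverse is the inverse: [y = y (x x^-1) = (y x) x^-1 = x^-1]. *)
Lemma groupoid_inv_unique x y : src T y = tgt T x ->
  mul T y x = ident T (src T x) -> y = inv T x.
Proof.
move=> yx yx1; have xV : idom T x by have [_ -> _] := T_grp.
rewrite -[LHS](mul_identr T) yx -(mul_invr xV) -groupoid_mulA ?tgt_inv// yx1.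
by rewrite -(tgt_inv xV) mul_identl.
Qed.

End TopologicalGroupoid.

Section Extension.
Variables (G M : topologicalType) (S : localGroupoid G M).
Hypothesis S_inv : inversional S.
Variables (H N : topologicalType) (T : localGroupoid H N).
Hypothesis T_grp : topological_groupoid T.
Variables (F : G -> H) (f : M -> N).
Hypothesis Ff : morphism S T F f.
Local Notation joinable := (joinable S).
Local Notation AC := (assoc_completion S).
Local Notation cmap := (completion_map S).
Local Notation A := (ac_groupoid S_inv).

Implicit Types w v : word S.

(* [s] acts on arrows of T by successive left multiplications, so that the value
   of a word is obtained by letting it act on a unit. *)
Definition act (s : seq G) (y : H) : H := foldr (fun g => mul T (F g)) y s.

(** The letter [g] in front of [s] covers the empty sequence uniformly: it is then [g] that meets
    [y]. *)
Lemma act_ends g s y : path joinable g s -> f (src S (last g s)) = tgt T y ->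
  src T (act s y) = src T y /\ tgt T (act s y) = f (src S g).
Proof.
elim: s g => [|h s ih] g /=; first by move=> _ ->.
move=> /andP[/eqP gh hs] sy; have [srcE tgtE] := ih h hs sy.
have Fh : mdom T (F h, act s y).
  by apply: groupoid_mdom => //; rewrite tgtE (morphism_src Ff).
by rewrite src_mul// tgt_mul// srcE -(morphism_tgt Ff) gh.
Qed.

Lemma act_mul g s y z : path joinable g s -> f (src S (last g s)) = tgt T y ->
  src T y = tgt T z -> mul T (act s y) z = act s (mul T y z).
Proof.
move=> + + yz; elim: s g => //= h s ih g /andP[/eqP gh hs] sy.
have [srcE tgtE] := act_ends hs sy.
rewrite groupoid_mulA ?srcE ?tgtE ?(morphism_src Ff)//.
by rewrite (ih h).
Qed.

Definition word_value (w : word S) : H :=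
  act (letters w) (ident T (f (word_src w))).

(** The unit at the target of the word serves as the front letter in the lemmas on [act]. *)
Lemma word_path w : path joinable (ident S (word_tgt w)) (letters w).
Proof.
have := letters_sorted w; have x := letter (w := w) ord0.
rewrite (word_tgtE x); case: (letters w) => //= g s ->.
by rewrite andbT; apply/eqP; rewrite src_ident.
Qed.

Lemma word_last w y : f (word_src w) = tgt T y ->
  f (src S (last (ident S (word_tgt w)) (letters w))) = tgt T y.
Proof. by rewrite (word_srcE (ident S (word_tgt w))). Qed.

Lemma word_value_src w : src T (word_value w) = f (word_src w).
Proof.
have := word_last (w := w) (y := ident T (f (word_src w))).
move=> /(_ _)/(act_ends (word_path w))[|-> _].
  by rewrite tgt_ident.
by rewrite src_ident.
Qed.

Lemma word_value_tgt w : tgt T (word_value w) = f (word_tgt w).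
Proof.
have := word_last (w := w) (y := ident T (f (word_src w))).
move=> /(_ _)/(act_ends (word_path w))[|_ ->].
  by rewrite tgt_ident.
by rewrite src_ident.
Qed.

Lemma word_value_cat w w' (ww' : word_src w = word_tgt w') :
  word_value (word_cat ww') = mul T (word_value w) (word_value w').
Proof.
have ww'f : tgt T (word_value w') = f (word_src w).
  by rewrite word_value_tgt ww'.
rewrite [in RHS]/word_value (act_mul (word_path w)).
(* [word_value w] is an action on a unit, and that unit is absorbed by [word_value w']. *)
- rewrite -ww'f mul_identl /word_value letters_cat /act foldr_cat; congr foldr.
  congr (foldr _ (ident T (f _)) _).
  have x := letter (w := w) ord0.
  rewrite !(word_srcE x) letters_cat last_cat.
  by case: (letters w') (@letters_nil _ _ _ w').
- by apply: word_last; rewrite tgt_ident.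
- by rewrite src_ident.
Qed.

Lemma word_value_contraction w w' :
  contraction w w' -> word_value w = word_value w'.
Proof.
move=> c; have e : word_src w = word_src w' by apply/word_equiv_src/rst_step.
move: c => [p [q [g [h [gh wE w'E]]]]].
rewrite /word_value -e wE w'E /act !foldr_cat /=; congr foldr.
(* By associativity in [T], [mul S g h] acts as [h] followed by [g]. *)
rewrite (morphism_mul Ff gh) groupoid_mulA//.
  by rewrite -(morphism_src Ff) -(morphism_tgt Ff) (mdom_composable gh).
have hq : path joinable h q.
  have := (cat_sorted2 (etrans (congr1 _ (esym wE)) (letters_sorted w))).2.
  by move=> /= /andP[].
have [|_ ->] := act_ends hq (y := ident T (f (word_src w))).
  by rewrite tgt_ident (word_srcE g) wE last_cat.
by rewrite (morphism_src Ff).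
Qed.

Lemma word_value_equiv w w' :
  clos_refl_sym_trans _ (contraction (S := S)) w w' ->
  word_value w = word_value w'.
Proof.
by elim=> // {w w'} => [w w' /word_value_contraction|w v w' _ -> _ ->].
Qed.

Definition extension (a : AC) : H := word_value (repr a : word S).

Lemma extension_class w : extension (word_class w) = word_value w.
Proof. exact/word_value_equiv/repr_word_class. Qed.

Lemma extension_map g : extension (cmap g) = F g.
Proof.
rewrite extension_class /word_value (word_srcE g) letters_word1 /=.
by rewrite (morphism_src Ff) mul_identr.
Qed.

Lemma extension_src a : src T (extension a) = f (ac_src a).
Proof. exact: word_value_src. Qed.

Lemma extension_tgt a : tgt T (extension a) = f (ac_tgt a).
Proof. exact: word_value_tgt. Qed.

Lemma extension_mul a b : ac_src a = ac_tgt b ->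
  extension (ac_mul a b) = mul T (extension a) (extension b).
Proof.
have [[w <-] [w' <-]] := (word_class_surj a, word_class_surj b).
rewrite ac_src_class ac_tgt_class => ww'.
by rewrite (ac_mul_class ww') !extension_class word_value_cat.
Qed.

Lemma extension_continuous : continuous extension.
Proof.
suff near c C :
    nbhs (extension c) C -> nbhs c (extension @^-1` C) by exact: near.
move: c C; apply: (ac_ind S_inv) => [g gV|a b ab iha ihb] C.
  rewrite extension_map => /(morphism_continuous Ff) nC.
  apply: filterS (completion_map_nbhs S nC) => _ [h Ch <-].
  by rewrite /= extension_map.
have T_mdom a' b' :
    ac_src a' = ac_tgt b' -> mdom T (extension a', extension b').
  move=> a'b'; apply: groupoid_mdom => //.
  by rewrite extension_src extension_tgt a'b'.
(* Continuity of the multiplication of [T] reduces the claim to the two factors, where the induction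
   hypotheses apply. *)
rewrite extension_mul// => /(mul_near (T_mdom _ _ ab))[X [Y [nX nY XY]]].
apply: filterS (ac_mul_nbhs ab (iha _ nX) (ihb _ nY)).
move=> _ [a' [b' [Xa Yb a'b' ->]]].
rewrite /= extension_mul//.
by have [] := XY _ _ Xa Yb (mdom_composable (T_mdom _ _ a'b')).
Qed.

Lemma extension_morphism : morphism A T extension f.
Proof.
have [Tm Tv _] := T_grp; split=> //=.
- exact: extension_continuous.
- exact: morphism_base_continuous Ff.
- by move=> x; rewrite extension_map (morphism_ident Ff).
- by move=> a; rewrite extension_src.
- by move=> a; rewrite extension_tgt.
- move=> a b ab; apply: groupoid_mdom => //.
  by rewrite extension_src extension_tgt ab.
- by move=> a b; exact: extension_mul.
- by move=> a _; rewrite Tv.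
- move=> a _; have [a's a't a'a _] := ac_invP S_inv a.
  (* The extension respects products and units, so it sends [ac_inv a] to a left inverse. *)
  apply: groupoid_inv_unique => //.
    by rewrite extension_src extension_tgt a's.
  rewrite -extension_mul// a'a extension_map (morphism_ident Ff).
  by rewrite extension_src.
Qed.

End Extension.

(** * The completion map and its universal property *)

Lemma completion_map_morphism (G M : topologicalType) (S : localGroupoid G M)
    (S_inv : inversional S) :
  morphism S (ac_groupoid S_inv) (completion_map S) id.
Proof.
split=> //=.
- exact: completion_map_continuous.
- by move=> x; exact: cvg_id.
- by move=> g; rewrite ac_src_map.
- by move=> g; rewrite ac_tgt_map.
- move=> g h gh; rewrite /composable /= ac_src_map ac_tgt_map.
  exact: mdom_composable gh.
- exact: completion_map_mul.
- by move=> g gV; apply/esym/ac_inv_unique => //; exact: ac_inverse_map.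
Qed.

Theorem proposition1p3 (G M : topologicalType) (S : localGroupoid G M)
    (S_assoc : three_associative S) (S_inversional : inversional S) :
  exists A : localGroupoid (assoc_completion S) M,
    [/\ completion_structure A,
        topological_groupoid A,
        morphism S A (completion_map S) (@id M)
      & forall (H N : topologicalType) (T : localGroupoid H N),
          topological_groupoid T ->
          forall (F : G -> H) (f : M -> N), morphism S T F f ->
          exists! Ff : (assoc_completion S -> H) * (M -> N),
            [/\ morphism A T Ff.1 Ff.2,
                F = Ff.1 \o completion_map S
              & f = Ff.2 \o @id M]].
Proof.
exists (ac_groupoid S_inversional); split.
- split; [exact: ac_src_class|exact: ac_tgt_class|by []|exact: ac_mul_class].
- by split=> // a b c; exact: ac_mulA.
- exact: completion_map_morphism.
- move=> H N T T_grp F f Ff; exists (extension T F f, f); split.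
    split=> //; first exact: extension_morphism.
    by apply/funext => g; exact/esym/(extension_map T_grp Ff).
  move=> [F' f'] [/= F'm FE fE]; congr pair; last exact: fE.
  (* Uniqueness: both maps agree with [F] on generators and respect products. *)
  apply/funext.
  apply: (ac_ind S_inversional) => [g _|a b ab iha ihb].
    transitivity (F g); first exact: (extension_map T_grp Ff).
    by rewrite FE.
  by rewrite (extension_mul T_grp Ff)// iha ihb (morphism_mul F'm).
Qed.
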